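(* Let $\mathcal{B}$ be a bounding family on $[n]^d$ and $\varepsilon>0$. There is a distribution-free, non-adaptive, one-sided error tester for $\mathcal{P}(\mathcal{B})$ (functions $f:[n]^d\to\mathbb{R}$) with respect to an unknown product distribution $\mathcal{D}$ on $[n]^d$ with proximity parameter $\varepsilon$, making $100\,\varepsilon^{-1}d\log n$ queries.
   Context: A bounding family is a tuple of $2d$ functions $l_1,u_1,\dots,l_d,u_d:[n-1]\to\mathbb{R}$ with $l_r(y)<u_r(y)$. $\mathcal{P}(\mathcal{B})$ is the set of $f:[n]^d\to\mathbb{R}$ with $l_r(x_r)\le f(x+\mathbf{e}_r)-f(x)\le u_r(x_r)$ for all $r$ and $x$ with $x_r<n$. $\mathrm{dist}_{\mathcal{D}}(f,\mathcal{P})=\inf_{g\in\mathcal{P}}\Pr_{x\sim\mathcal{D}}[f(x)\ne g(x)]$. A distribution-free tester does not know $\mathcal{D}$ but can draw independent samples from $\mathcal{D}$ and query $f$ at any point of $[n]^d$; it must accept with probability $>2/3$ if $f\in\mathcal{P}(\mathcal{B})$ and reject with probability $>2/3$ if $\mathrm{dist}_{\mathcal{D}}(f,\mathcal{P}(\mathcal{B}))>\varepsilon$. Non-adaptive: queries do not depend on answers; one-sided: functions in the property are always accepted. *)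

(* Defs.v *)
From HB Require Import structures.
From mathcomp Require Import all_boot all_order all_algebra.
From mathcomp Require Import boolp classical_sets reals exp.
Set Implicit Arguments. Unset Strict Implicit. Unset Printing Implicit Defensive.
Import Order.TTheory GRing.Theory Num.Theory.
Local Open Scope ring_scope.

Section Defs.
Variables (R : realType) (n d : nat).

(* A cpoint of [n]^d, coordinates 0-indexed: x r in {0,..,n-1} stands for x_r+1. *)
Definition cpoint := {ffun 'I_d -> 'I_n}.

(* x + e_r (only used when (x r).+1 < n). *)
Definition shift (x : cpoint) (r : 'I_d) : cpoint :=
  [ffun j => if j == r then insubd (x r) (x r).+1 else x j].

(* Bounding family: l r, u r : [n-1] -> R (0-indexed: arguments y < n-1),
   with l r y < u r y. Values at y >= n-1 are irrelevant. *)
Definition bounding_family (l u : 'I_d -> nat -> R) : Prop :=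
  forall r y, (y < n.-1)%N -> l r y < u r y.

Definition inP (l u : 'I_d -> nat -> R) (f : cpoint -> R) : Prop :=
  forall (r : 'I_d) (x : cpoint), ((x r).+1 < n)%N ->
    l r (x r) <= f (shift x r) - f x <= u r (x r).

Definition is_marginals (p : 'I_d -> 'I_n -> R) : Prop :=
  (forall r i, 0 <= p r i) /\ (forall r, \sum_(i : 'I_n) p r i = 1).
Definition prodD (p : 'I_d -> 'I_n -> R) (x : cpoint) : R := \prod_(r : 'I_d) p r (x r).

Definition PrD (D : cpoint -> R) (E : pred cpoint) : R := \sum_(x : cpoint | E x) D x.

Definition distD (D : cpoint -> R) (l u : 'I_d -> nat -> R) (f : cpoint -> R) : R :=
  inf [set e | exists g, inP l u g /\ e = PrD D (fun x => f x != g x)].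

(* A randomized, distribution-free, non-adaptive tester:
   internal randomness w drawn from a finite probability space (Omega, mu);
   it draws m independent samples s from D, receiving their labels f(s_i)
   (each sample counts as a query), then makes q queries chosen as a function
   of (w, s) only (non-adaptive: independent of all answers), and decides
   from (w, s, labels, answers).  It does not know D. *)
Record tester := Tester {
  Omega : finType;
  mu : Omega -> R;
  nsamples : nat;
  nqueries : nat;
  queries : Omega -> nsamples.-tuple cpoint -> nqueries.-tuple cpoint;
  decide : Omega -> nsamples.-tuple cpoint -> nsamples.-tuple R ->
           nqueries.-tuple R -> bool
}.
Arguments mu t w : clear implicits.
Arguments queries t w s : clear implicits.
Arguments decide t w s _ _ : clear implicits.

Definition valid_randomness (T : tester) : Prop :=
  (forall w, 0 <= mu T w) /\ \sum_(w : Omega T) mu T w = 1.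

Definition query_complexity (T : tester) : nat := (nsamples T + nqueries T)%N.

Definition acc_prob (T : tester) (D : cpoint -> R) (f : cpoint -> R) : R :=
  \sum_(w : Omega T) mu T w *
    \sum_(s : (nsamples T).-tuple cpoint)
       (\prod_(i < nsamples T) D (tnth s i)) *
       (decide T w s (map_tuple f s) (map_tuple f (queries T w s)))%:R.

Definition log2 (x : R) : R := ln x / ln 2.

End Defs.

(* Main.v *)
Require Import Defs.
From HB Require Import structures.
From mathcomp Require Import all_boot all_order all_algebra.
From mathcomp Require Import boolp classical_sets reals exp.
From mathcomp Require Import zify ring lra.
Set Implicit Arguments. Unset Strict Implicit. Unset Printing Implicit Defensive.
Import Order.TTheory GRing.Theory Num.Theory.
Local Open Scope ring_scope.

(* Let m be the quasi-metric for which P(B) is the set of f with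
   f x <= f y + m x y for all x, y.  By a dyadic search on the lines of direction r,
   each round detects a violation with probability X_r, the mass of a vertex cover
   of all violations along these lines.  It remains to bound the distance to P(B)
   by 8 * \sum_r X_r (dimension reduction).

   For a set s of directions let W_eta(f, s) be the least cost E[q - p] of a
   bracket p <= f <= q with p x <= q y + m x y + eta whenever x and y agree off s;
   W_0 is the L1 distance to the functions with no violation along s.  The gain
   G(f, s) = W_0(f, s) - W_eta(f, s) has three properties.
   - For small eta, G(f, all directions) is at least eta / 2 times the distance of
     f to P(B).
   - Changing f on a set of mass X changes G by at most 2 * eta * X: an exchange
     argument on two brackets.
   - If f has no violation along r, then W_0(f, r :: s) <= W_0(f, s), because L1
     projection of the slices is monotone and commutes with constants; hence
     G(f, r :: s) <= G(f, s).
   Repairing f along r on a set of mass X_r and adding the directions one at a time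
   gives G(f, all) <= 4 * eta * \sum_r X_r. *)

(* Innermost occurrences first, so that no case hypothesis contains a min or
   max. *)
Ltac minmax_free t :=
  lazymatch t with
  | context [Order.max _ _] => fail
  | context [Order.min _ _] => fail
  | _ => idtac
  end.
Ltac minmax_cases :=
  repeat match goal with
  | |- context [Order.max ?a ?b] => minmax_free a; minmax_free b; case: (leP a b) => ?
  | |- context [Order.min ?a ?b] => minmax_free a; minmax_free b; case: (leP a b) => ?
  end.
Ltac minmax := minmax_cases; lra.

(** * Clamping and rearrangement inequalities on the real line *)

Section RealInequalities.
Variable R : realType.
Implicit Types a b c k p q f eta : R.

Definition clamp a b p := Num.max a (Num.min p b).

Lemma clamp_ge a b p : a <= clamp a b p.
Proof. by rewrite /clamp le_max lexx. Qed.

Lemma clamp_le a b p : a <= b -> clamp a b p <= b.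
Proof. by move=> ab; rewrite /clamp ge_max ab ge_min lexx orbT. Qed.

Lemma clamp_ge_arg a b p c : c <= b -> c <= p -> c <= clamp a b p.
Proof. by move=> cb cp; rewrite /clamp le_max le_min cb cp orbT. Qed.

Lemma clamp_le_arg a b p c : a <= c -> p <= c -> clamp a b p <= c.
Proof. by move=> ac pc; rewrite /clamp ge_max ac ge_min pc. Qed.

(** Two brackets trade the slack [eta]: the ends [p], [q] move inwards and the ends [p'], [q']
    outwards, each by at most [eta] and towards the other bracket. *)
Lemma clamp_exchange eta p q p' q' c : 0 <= eta ->
  p <= q + c -> p' <= q' + c + eta ->
  clamp p (p + eta) p' <= clamp (q - eta) q q' + c + eta /\
  clamp (p' - eta) p' p <= clamp q' (q' + eta) q + c.
Proof.
move=> eta0 pq pq'; split.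
  rewrite -!lerBlDr {1}/clamp.
  case: (leP p (Num.min p' (p + eta))) => h.
    apply: clamp_ge_arg; rewrite !lerBlDr ge_min; apply/orP; [right|left]; lra.
  by apply: le_trans (clamp_ge _ _ _); lra.
rewrite -!lerBlDr {1}/clamp.
case: (leP (p' - eta) (Num.min p p')) => h.
  by apply: clamp_ge_arg; rewrite !lerBlDr ge_min; apply/orP; [right|left]; lra.
by apply: le_trans (clamp_ge _ _ _); lra.
Qed.

(** The truncation of [p' - p] to [0, eta] is added to [p] and taken away from [p']. *)
Lemma clamp_add eta p p' : 0 <= eta ->
  clamp p (p + eta) p' + clamp (p' - eta) p' p = p + p'.
Proof. by rewrite /clamp => *; minmax. Qed.

Lemma exchange_le eta f p q p' q' : 0 <= eta -> p <= f <= q -> p' <= f <= q' ->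
  Num.max f (clamp (q - eta) q q') - Num.min f (clamp p (p + eta) p')
  + (clamp q' (q' + eta) q - clamp (p' - eta) p' p)
  <= (q - p) + (q' - p').
Proof.
move=> eta0 /andP[pf fq] /andP[pf' fq'].
rewrite max_r ?clamp_ge_arg // min_r ?clamp_le_arg //.
by have := clamp_add p p' eta0; have := clamp_add q' q eta0; lra.
Qed.

(** For the points where the two functions differ: the first pair stays inside [p, q], and each end
    of the second moves out by at most [eta]. *)
Lemma exchange_le_gap eta f p q p' q' : 0 <= eta -> p <= f <= q ->
  Num.max f (clamp (q - eta) q q') - Num.min f (clamp p (p + eta) p')
  + (clamp q' (q' + eta) q - clamp (p' - eta) p' p)
  <= (q - p) + (q' - p') + 2 * eta.
Proof.
move=> eta0 /andP[pf fq].
have h1 : Num.max f (clamp (q - eta) q q') <= q.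
  by rewrite ge_max fq clamp_le //; lra.
have h2 : p <= Num.min f (clamp p (p + eta) p') by rewrite le_min pf clamp_ge.
have h3 : clamp q' (q' + eta) q <= q' + eta by apply: clamp_le; lra.
have h4 : p' - eta <= clamp (p' - eta) p' p by apply: clamp_ge.
lra.
Qed.

(** On the line, matching two points with two others in sorted order is cheapest. *)
Lemma dist_minmax_le a b k k' : a <= b ->
  `|a - Num.min k k'| + `|b - Num.max k k'| <= `|a - k| + `|b - k'|.
Proof.
move=> ab; case: (leP k k') => [//|kk].
case: (ger0P (a - k)); case: (ger0P (a - k'));
case: (ger0P (b - k)); case: (ger0P (b - k')); lra.
Qed.

Lemma shrunk_width t f g : 0 <= t ->
  Num.max f (Num.max f g - t) - Num.min f (Num.min f g + t)
  = Num.max 0 (`|f - g| - t).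
Proof.
move=> t0; case: (leP f g) => fg.
  by rewrite ler0_norm ?subr_le0 // (min_l (y := f + t)) ?lerDl //; minmax.
by rewrite gtr0_norm ?subr_gt0 // (max_l (y := f - t)) ?gerBl //; minmax.
Qed.

End RealInequalities.

(** * Minima over finite types *)

Section FiniteMinimum.
Variables (R : realType) (V : finType).

Lemma finite_min (P : pred V) (F : V -> R) :
  (exists x, P x) -> exists2 y, P y & forall z, P z -> F y <= F z.
Proof.
case=> x0 Px0; case: (arg_minP F Px0) => y Py ymin.
by exists y => // z; exact: ymin.
Qed.

Lemma positive_gap (F : V -> R) :
  exists2 eta, 0 < eta & forall x, 0 < F x -> eta <= F x.
Proof.
have [E|E] := pselect (exists x, 0 < F x).
  by have [y Fy ymin] := finite_min F E; exists (F y).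
exists 1 => // x Fx; case: E; by exists x.
Qed.

End FiniteMinimum.

Definition mass (R : realType) (V : finType) (D : V -> R) (E : pred V) : R :=
  \sum_(x | E x) D x.

Lemma mass_ge0 (R : realType) (V : finType) (D : V -> R) (E : pred V) :
  (forall x, 0 <= D x) -> 0 <= mass D E.
Proof. by move=> D0; apply: sumr_ge0. Qed.

(** * Lipschitz functions and brackets for a quasi-metric on a finite set *)

Section Lipschitz.
Variables (R : realType) (V : finType).
Variables (m : V -> V -> R) (D : V -> R).
Hypothesis m_refl : forall x, m x x = 0.
Hypothesis m_tri : forall x y z, m x z <= m x y + m y z.
Hypothesis D_ge0 : forall x, 0 <= D x.
Implicit Types (e : rel V) (f g h p q : V -> R).

Definition lip e g := forall x y, e x y -> g x <= g y + m x y.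

Definition L1 f g := \sum_x D x * `|f x - g x|.

(** McShane's formula: the minimum of [q y + m x y] over the points [y] of [P] in the class of [x].
    It is attained by finiteness and Lipschitz by the triangle inequality. *)
Lemma inf_convolution e (P : pred V) q : equivalence_rel e ->
  (forall x, exists y, P y && e x y) ->
  exists g, [/\ lip e g, forall x y, P y -> e x y -> g x <= q y + m x y &
    forall x, exists y, [/\ P y, e x y & g x = q y + m x y]].
Proof.
move=> eqe Pe.
have /choice[c cP] : forall x, exists y, (P y && e x y) /\
    forall z, P z && e x z -> q y + m x y <= q z + m x z.
  move=> x; have [y Py ymin] := finite_min (fun y => q y + m x y) (Pe x).
  by exists y.
exists (fun x => q (c x) + m x (c x)); split.
- move=> x y exy; have [_ cmin] := cP x; have [/andP[Pc ec] _] := cP y.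
  apply: le_trans (cmin (c y) _) _; first by rewrite Pc (eqe x y (c y)).2.
  by have := m_tri x y (c y); lra.
- by move=> x y Py exy; have [_ ->] := cP x; rewrite ?Py.
- by move=> x; have [/andP[? ?] _] := cP x; exists (c x).
Qed.

Lemma lip_extension e (G : pred V) f h : equivalence_rel e -> lip e h ->
  (forall x y, G x -> G y -> e x y -> f x <= f y + m x y) ->
  exists g, lip e g /\ forall x, G x -> g x = f x.
Proof.
move=> eqe hlip fG.
(* A class without points of [G] takes part with all its points and the values of [h], so that [P]
   meets every class. *)
pose P y := G y || ~~ [exists z, G z && e y z].
have [|g [glip gle gE]] :=
    @inf_convolution e P (fun y => if G y then f y else h y) eqe.
  move=> x; have [/existsP[z /andP[Gz exz]]|N] := boolP [exists z, G z && e x z].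
    by exists z; rewrite /P Gz.
  by exists x; rewrite /P N orbT (eqe x x x).1.
exists g; split => // x Gx; apply/le_anti/andP; split.
  have := gle x x; rewrite /P Gx (eqe x x x).1 m_refl addr0; exact.
have [y [Py exy ->]] := gE x.
have Gy : G y.
  case/orP: Py => // /existsP[]; exists x.
  by rewrite Gx -((eqe x y x).2 exy) (eqe x x x).1.
by rewrite Gy; apply: fG.
Qed.

Definition bracket e eta f p q :=
  (forall x, p x <= f x <= q x) /\
  (forall x y, e x y -> p x <= q y + m x y + eta).

Definition width p q := \sum_x D x * (q x - p x).

Definition bracket_width e eta f : R :=
  inf [set w | exists p q, bracket e eta f p q /\ w = width p q].

Lemma width_ge0 e eta f p q : bracket e eta f p q -> 0 <= width p q.
Proof.
case=> pq _; apply: sumr_ge0 => x _; apply: mulr_ge0 => //.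
by have := pq x; lra.
Qed.

Lemma bracket_width_le e eta f p q :
  bracket e eta f p q -> bracket_width e eta f <= width p q.
Proof.
move=> b; apply: ge_inf; last by exists p, q.
by exists 0 => w [p' [q' [b' ->]]]; exact: width_ge0 b'.
Qed.

Lemma bracket_weaken e eta eta' f p q : eta <= eta' ->
  bracket e eta f p q -> bracket e eta' f p q.
Proof. by move=> le [pq pqm]; split=> // x y exy; have := pqm x y exy; lra. Qed.

Lemma bracket_of_lip e f g : lip e g ->
  bracket e 0 f (fun x => Num.min (f x) (g x)) (fun x => Num.max (f x) (g x)).
Proof.
move=> glip; split=> [x|x y exy]; first by rewrite ge_min le_max lexx.
by have := glip x y exy; minmax.
Qed.

Lemma width_minmax f g :
  width (fun x => Num.min (f x) (g x)) (fun x => Num.max (f x) (g x)) = L1 f g.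
Proof.
apply: eq_bigr => x _; congr (_ * _); case: (leP (f x) (g x)) => fg.
  by rewrite ler0_norm; lra.
by rewrite ger0_norm; lra.
Qed.

(** Without slack, the inf-convolution of [q] is squeezed between [p] and [q]. Together with
    [bracket_of_lip] this identifies W_0 with the L1 distance. *)
Lemma lip_of_bracket e f p q : equivalence_rel e -> bracket e 0 f p q ->
  exists2 g, lip e g & L1 f g <= width p q.
Proof.
move=> eqe [pq pqm].
have [|g [glip gle gE]] := @inf_convolution e predT q eqe.
  by move=> x; exists x; rewrite (eqe x x x).1.
exists g => //; apply: ler_sum => x _; apply: ler_wpM2l => //.
have gq : g x <= q x.
  by have := gle x x; rewrite (eqe x x x).1 m_refl addr0; exact.
have pg : p x <= g x.
  by have [y [_ exy ->]] := gE x; have := pqm x y exy; lra.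
by rewrite ler_norml; have := pq x; lra.
Qed.

Section Potential.
Variable h : V -> R.
Hypothesis h_lip : forall x y, h x <= h y + m x y.

(** The Lipschitz function [h] supplies a bracket, so the infimum is over a nonempty set. *)
Lemma bracket_width_approx e eta f delta : 0 <= eta -> 0 < delta ->
  exists p q, bracket e eta f p q /\ width p q <= bracket_width e eta f + delta.
Proof.
move=> eta0 d0.
have [|w [p [q [b ->]]] wlt] := inf_adherent d0 (E := [set w | exists p q,
    bracket e eta f p q /\ w = width p q]).
  split; last by exists 0 => w [p' [q' [b' ->]]]; exact: width_ge0 b'.
  exists (L1 f h); rewrite -width_minmax; do 2!eexists; split; last reflexivity.
  by apply: (bracket_weaken eta0); apply: bracket_of_lip => x y _.
by exists p, q; split => //; apply: ltW.
Qed.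

Lemma bracket_width_ge0 e eta f : 0 <= eta -> 0 <= bracket_width e eta f.
Proof.
move=> eta0; apply/ler_addgt0Pr => d /(bracket_width_approx e f eta0)[p [q [b]]].
by apply: le_trans; apply: width_ge0 b.
Qed.

Lemma bracket_width_mono e e' eta f : 0 <= eta -> subrel e e' ->
  bracket_width e eta f <= bracket_width e' eta f.
Proof.
move=> eta0 ee'.
apply/ler_addgt0Pr => d /(bracket_width_approx e' f eta0)[p [q [[pq pqm]]]].
apply: le_trans; apply: bracket_width_le; split => // x y /ee'; exact: pqm.
Qed.

(** This bounds the change of the gain W_0 - W_eta between [f] and [f']. Near-optimal brackets for
    the right-hand side are exchanged by clamping; the min and max with [f] keep [f] inside the
    first new bracket. *)
Lemma bracket_width_exchange e eta f f' : 0 <= eta ->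
  bracket_width e eta f + bracket_width e 0 f'
  <= bracket_width e 0 f + bracket_width e eta f'
     + 2 * eta * mass D (fun x => f x != f' x).
Proof.
move=> eta0; apply/ler_addgt0Pr => d d0.
have d2 : 0 < d / 2 by lra.
have [p [q [[pq pqm] wle]]] := bracket_width_approx e f (lexx 0) d2.
have [p' [q' [[pq' pqm'] wle']]] := bracket_width_approx e f' eta0 d2.
have b1 : bracket e eta f
    (fun x => Num.min (f x) (clamp (p x) (p x + eta) (p' x)))
    (fun x => Num.max (f x) (clamp (q x - eta) (q x) (q' x))).
  split=> [x|x y exy]; first by rewrite ge_min le_max lexx.
  have pq0 : p x <= q y + m x y by have := pqm x y exy; rewrite addr0.
  have [le1 _] := clamp_exchange eta0 pq0 (pqm' x y exy).
  rewrite ge_min; apply/orP; right; apply: le_trans le1 _.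
  by rewrite !lerD2r le_max lexx orbT.
have b2 : bracket e 0 f' (fun x => clamp (p' x - eta) (p' x) (p x))
    (fun x => clamp (q' x) (q' x + eta) (q x)).
  split=> [x|x y exy].
    have := pq' x.
    move=> /andP[pf' fq']; apply/andP; split.
      by apply: le_trans pf'; apply: clamp_le; lra.
    by apply: le_trans fq' _; apply: clamp_ge.
  have pq0 : p x <= q y + m x y by have := pqm x y exy; rewrite addr0.
  by have [_ le2] := clamp_exchange eta0 pq0 (pqm' x y exy); rewrite addr0.
have := bracket_width_le b1; have := bracket_width_le b2.
suff : width (fun x => Num.min (f x) (clamp (p x) (p x + eta) (p' x)))
    (fun x => Num.max (f x) (clamp (q x - eta) (q x) (q' x)))
  + width (fun x => clamp (p' x - eta) (p' x) (p x))
      (fun x => clamp (q' x) (q' x + eta) (q x))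
  <= width p q + width p' q' + 2 * eta * mass D (fun x => f x != f' x) by lra.
rewrite /width /mass [X in _ * X]big_mkcond mulr_sumr -!big_split.
apply: ler_sum => x _ /=.
rewrite -!mulrDr; have [ff'|ff'] := eqVneq (f x) (f' x).
  rewrite mulr0 addr0; apply: ler_wpM2l => //.
  by apply: exchange_le => //; rewrite ff'.
have := ler_wpM2l (D_ge0 x) (exchange_le_gap (p' x) (q' x) eta0 (pq x)).
by move=> /= /le_trans; apply; lra.
Qed.

(* With eta below every positive violation of f, the points where a nearly
   optimal g is within eta / 2 of f are free of violations, and shrinking the
   bracket by eta / 2 on both sides pays eta / 2 on all other points. *)
Lemma lip_dist_le_gain f : exists2 eta, 0 < eta &
  forall delta, 0 < delta -> exists2 g, lip (fun _ _ => true) g &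
    eta / 2 * mass D (fun x => f x != g x)
    <= bracket_width (fun _ _ => true) 0 f - bracket_width (fun _ _ => true) eta f
       + delta.
Proof.
have [eta eta0 etaP] :=
  @positive_gap R (V * V)%type (fun z => f z.1 - f z.2 - m z.1 z.2).
have eqe : equivalence_rel (fun _ _ : V => true) by [].
exists eta => // delta d0.
have [p [q [b wle]]] := bracket_width_approx (fun _ _ => true) f (lexx 0) d0.
have [g0 g0lip g0le] := lip_of_bracket eqe b.
have [|g [glip gE]] := @lip_extension (fun _ _ => true)
    (fun x => `|f x - g0 x| < eta / 2) f h eqe (fun x y _ => h_lip x y).
  move=> x y; rewrite !ltr_norml => Gx Gy _; rewrite leNgt; apply/negP => lt.
  by have := etaP (x, y); have := g0lip x y isT => /= ? /(_ ltac:(lra)); lra.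
exists g => //.
pose p1 x := Num.min (f x) (Num.min (f x) (g0 x) + eta / 2).
pose q1 x := Num.max (f x) (Num.max (f x) (g0 x) - eta / 2).
have b1 : bracket (fun _ _ => true) eta f p1 q1.
  split=> [x|x y exy]; first by rewrite ge_min le_max lexx.
  apply: (@le_trans _ _ (g0 x + eta / 2)).
    by rewrite ge_min lerD2r ge_min lexx !orbT.
  apply: (@le_trans _ _ (g0 y - eta / 2 + m x y + eta)); last first.
    by rewrite !lerD2r le_max lerD2r le_max lexx !orbT.
  by have := g0lip x y isT; lra.
have le1 := bracket_width_le b1.
suff : eta / 2 * mass D (fun x => f x != g x) + width p1 q1 <= L1 f g0 by lra.
rewrite /mass big_mkcond mulr_sumr -big_split.
apply: ler_sum => x _ /=.
have -> : q1 x - p1 x = Num.max 0 (`|f x - g0 x| - eta / 2).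
  by apply: shrunk_width; lra.
have [fg|fg] := eqVneq (f x) (g x).
  rewrite mulr0 add0r; apply: ler_wpM2l => //.
  by rewrite ge_max normr_ge0 gerBl; lra.
rewrite mulrC -mulrDr; apply: ler_wpM2l => //.
have : ~~ (`|f x - g0 x| < eta / 2).
  by apply/negP => /gE E; rewrite E eqxx in fg.
by rewrite -leNgt => h'; rewrite max_r; lra.
Qed.

End Potential.
End Lipschitz.

(** * The grid, its quasi-metric and product distributions *)

Section Grid.
Variables (R : realType) (n d : nat).
Implicit Types (x y z : cpoint n d) (s : seq 'I_d) (r : 'I_d) (a b c : 'I_n).

Definition upd x r a : cpoint n d := [ffun j => if j == r then a else x j].

Lemma upd_same x r a : upd x r a r = a.
Proof. by rewrite ffunE eqxx. Qed.

Lemma upd_other x r a i : i != r -> upd x r a i = x i.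
Proof. by rewrite ffunE => /negbTE->. Qed.

Lemma upd_id x r : upd x r (x r) = x.
Proof. by apply/ffunP => i; rewrite ffunE; case: eqP => // ->. Qed.

Lemma upd_upd x r a b : upd (upd x r a) r b = upd x r b.
Proof. by apply/ffunP => i; rewrite !ffunE; case: eqP. Qed.

Definition agree_off s : rel (cpoint n d) :=
  fun x y => [forall i, (i \notin s) ==> (x i == y i)].

Lemma agree_offP s x y :
  reflect (forall i, i \notin s -> x i = y i) (agree_off s x y).
Proof.
apply: (iffP forallP) => [h i is_|h i]; first exact/eqP/(implyP (h i)).
by apply/implyP => /h ->.
Qed.

Lemma agree_off_equiv s : equivalence_rel (agree_off s).
Proof.
move=> x y z; split; first by apply/agree_offP.
move=> /agree_offP xy; apply/agree_offP/agree_offP => h i is_.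
  by rewrite -xy // h.
by rewrite xy // h.
Qed.

Lemma agree_off_cons r s : subrel (agree_off s) (agree_off (r :: s)).
Proof.
move=> x y /agree_offP xy; apply/agree_offP => i.
by rewrite inE negb_or => /andP[_]; exact: xy.
Qed.

Lemma agree_off_line r x y : agree_off [:: r] x y -> y = upd x r (y r).
Proof.
move=> /agree_offP xy; apply/ffunP => i; rewrite ffunE.
by case: eqP => [->//|/eqP ir]; rewrite xy // inE.
Qed.

Section Quasimetric.
Variables l u : 'I_d -> nat -> R.

Definition psum (w : nat -> R) (k : nat) := \sum_(t < k) w t.

(* For i >= j this is the sum of u over [j, i), and for i <= j minus the sum of l
   over [i, j), as soon as l <= u; the maximum makes the triangle inequality
   immediate. *)
Definition qm1 r (i j : nat) : R :=
  Num.max (psum (u r) i - psum (u r) j) (psum (l r) i - psum (l r) j).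

Definition qm x y : R := \sum_r qm1 r (x r) (y r).

Lemma qm1_refl r i : qm1 r i i = 0.
Proof. by rewrite /qm1 !subrr maxxx. Qed.

Lemma qm1_tri r i j k : qm1 r i k <= qm1 r i j + qm1 r j k.
Proof.
rewrite /qm1 ge_max; apply/andP; split.
  rewrite -[X in X <= _](subrKA (psum (u r) j)).
  by apply: lerD; rewrite le_max lexx.
rewrite -[X in X <= _](subrKA (psum (l r) j)).
by apply: lerD; rewrite le_max lexx orbT.
Qed.

Lemma qm_refl x : qm x x = 0.
Proof. by apply: big1 => r _; exact: qm1_refl. Qed.

Lemma qm_tri x y z : qm x z <= qm x y + qm y z.
Proof. by rewrite -big_split; apply: ler_sum => r _; exact: qm1_tri. Qed.

(** All increments sit at their upper bound; this serves as the default Lipschitz function. *)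
Definition potential x : R := \sum_r psum (u r) (x r).

Lemma potential_lip x y : potential x <= potential y + qm x y.
Proof.
rewrite -lerBlDl -sumrB; apply: ler_sum => r _.
by rewrite /qm1 le_max lexx.
Qed.

Lemma qm_upd x y r : qm x y = qm1 r (x r) (y r) + qm (upd x r (y r)) y.
Proof.
rewrite /qm (bigD1 r) //= [in RHS](bigD1 r) //= upd_same qm1_refl add0r.
by congr (_ + _); apply: eq_bigr => i ir; rewrite upd_other.
Qed.

Lemma qm_line x r a b : qm (upd x r a) (upd x r b) = qm1 r a b.
Proof.
by rewrite (qm_upd _ _ r) !upd_same upd_upd qm_refl addr0.
Qed.

Lemma qm_upd_eq x y r a : x r = y r -> qm (upd x r a) (upd y r a) = qm x y.
Proof.
move=> xy; apply: eq_bigr => i _; rewrite !ffunE; case: eqP => // ->.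
by rewrite xy !qm1_refl.
Qed.

End Quasimetric.

Section Product.
Variable p : 'I_d -> 'I_n -> R.
Hypothesis p_marg : is_marginals p.

Lemma prodD_ge0 x : 0 <= prodD p x.
Proof. by apply: prodr_ge0 => r _; exact: p_marg.1. Qed.

Lemma prodD_sum1 : \sum_x prodD p x = 1.
Proof.
rewrite /prodD -(bigA_distr_bigA p) big1 // => r _; exact: p_marg.2.
Qed.

(** Cross-multiplied, since [p r (x r)] may vanish. *)
Lemma prodD_upd x r a : prodD p (upd x r a) * p r (x r) = prodD p x * p r a.
Proof.
rewrite /prodD (bigD1 r) //= [in RHS](bigD1 r) //= upd_same.
rewrite mulrAC [in RHS]mulrAC; congr (_ * _); first by rewrite mulrC.
by apply: eq_bigr => i ir; rewrite upd_other.
Qed.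

Lemma prodD_resample r (F : cpoint n d -> R) :
  \sum_x prodD p x * F x = \sum_a p r a * \sum_x prodD p x * F (upd x r a).
Proof.
under [RHS]eq_bigr => a _ do rewrite mulr_sumr.
rewrite pair_big /=.
(* Swapping the fresh coordinate with that of [x] is an involution that preserves the joint weight,
   by [prodD_upd]. *)
pose sw (z : 'I_n * cpoint n d) := (z.2 r, upd z.2 r z.1).
have swK : cancel sw sw.
  by move=> [a x]; rewrite /sw /= upd_same upd_upd upd_id.
rewrite [RHS](reindex sw) /=; last exact: onW_bij (Bijective swK swK).
transitivity (\sum_(z : 'I_n * cpoint n d) p r z.1 * (prodD p z.2 * F z.2)).
  rewrite -[LHS]mul1r -(p_marg.2 r) mulr_suml.
  rewrite (eq_bigr _ (fun a _ => mulr_sumr _ _ _ _)).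
  by rewrite pair_big.
apply: eq_bigr => -[a x] _; rewrite /= upd_upd upd_id !mulrA; congr (_ * _).
by rewrite mulrC -prodD_upd mulrC.
Qed.

End Product.

(** * Adding one direction by L1 projection of the slices *)

Section AddDimension.
Variables l u : 'I_d -> nat -> R.
Variable p : 'I_d -> 'I_n -> R.
Hypothesis p_marg : is_marginals p.
Variables (r : 'I_d) (s : seq 'I_d).
Hypothesis rs : r \notin s.
Let D := prodD p.
Let lips := lip (qm l u) (agree_off s).
Implicit Types f g h k : cpoint n d -> R.

(** Slices remain functions on the whole grid, constant along [r], so that no grid of lower
    dimension appears. *)
Let slice f a := fun x => f (upd x r a).
Let flat k := lips k /\ forall x a, k (upd x r a) = k x.

(** Projection up to a loss [delta], so that the infimum need not be attained. *)
Let near_opt f h delta := flat h /\ forall k, flat k -> L1 D f h <= L1 D f k + delta.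

Lemma agree_off_upd x y a : agree_off s x y ->
  agree_off s (upd x r a) (upd y r a) /\
  qm l u (upd x r a) (upd y r a) = qm l u x y.
Proof.
move=> /agree_offP xy; split; last by apply: qm_upd_eq; exact: xy.
by apply/agree_offP => i /xy; rewrite !ffunE; case: ifP.
Qed.

Lemma flat_slice k a : lips k -> flat (slice k a).
Proof.
move=> klip; split=> [x y /(agree_off_upd a)[xy <-]|x b]; first exact: klip.
by rewrite /slice upd_upd.
Qed.

Lemma flat_addc k (c : R) : flat k -> flat (fun x => k x + c).
Proof.
move=> [klip kflat]; split=> [x y /klip|x a]; first by lra.
by rewrite kflat.
Qed.

Lemma flat_min h k : flat h -> flat k -> flat (fun x => Num.min (h x) (k x)).
Proof.
move=> [hlip hflat] [klip kflat]; split=> [x y xy|x a]; last by rewrite hflat kflat.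
by have := hlip x y xy; have := klip x y xy; minmax.
Qed.

Lemma flat_max h k : flat h -> flat k -> flat (fun x => Num.max (h x) (k x)).
Proof.
move=> [hlip hflat] [klip kflat]; split=> [x y xy|x a]; last by rewrite hflat kflat.
by have := hlip x y xy; have := klip x y xy; minmax.
Qed.

Lemma L1_ge0 f g : 0 <= L1 D f g.
Proof. by apply: sumr_ge0 => x _; apply: mulr_ge0 => //; exact: prodD_ge0. Qed.

Lemma near_opt_exists f delta (a : 'I_n) : 0 < delta ->
  exists h, near_opt f h delta.
Proof.
move=> d0; pose A : set R := [set w | exists k, flat k /\ w = L1 D f k]%classic.
have lbA : has_lbound A by exists 0 => w [k [_ ->]]; exact: L1_ge0.
have [|_ [h [hflat ->]] hlt] := inf_adherent d0 (E := A).
  split=> //; exists (L1 D f (slice (potential u) a)), (slice (potential u) a).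
  by split => //; apply: flat_slice => x y _; exact: potential_lip.
exists h; split=> // k kflat; apply: le_trans (ltW hlt) _.
by rewrite lerD2r; apply: ge_inf => //; exists k.
Qed.

Lemma near_opt_addc f h delta (c : R) : near_opt f h delta ->
  near_opt (fun x => f x + c) (fun x => h x + c) delta.
Proof.
have L1c f' g : L1 D (fun x => f' x + c) g = L1 D f' (fun x => g x - c).
  by apply: eq_bigr => x _; rewrite opprB addrA addrAC.
move=> [hflat hopt]; split=> [|k kflat]; first exact: flat_addc.
rewrite !L1c (_ : (fun x => h x + c - c) = h); last first.
  by apply: funext => x; rewrite addrK.
by apply: hopt; apply: flat_addc.
Qed.

(* By [dist_minmax_le], a near-optimal h' for a larger function can be cut out of
   h at no more than the loss of h'. *)
Lemma near_opt_min f f' h h' delta delta' : (forall x, f x <= f' x) ->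
  near_opt f h delta -> near_opt f' h' delta' ->
  near_opt f (fun x => Num.min (h' x) (h x)) (delta' + delta).
Proof.
move=> ff' [hflat hopt] [hflat' hopt']; split=> [|k kflat]; first exact: flat_min.
have le1 := hopt k kflat; have le2 := hopt' _ (flat_max hflat hflat').
suff : L1 D f (fun x => Num.min (h' x) (h x)) +
    L1 D f' (fun x => Num.max (h x) (h' x)) <= L1 D f h + L1 D f' h' by lra.
rewrite -!big_split; apply: ler_sum => x _ /=.
rewrite -!mulrDr minC; apply: ler_wpM2l; first exact: prodD_ge0.
exact: dist_minmax_le.
Qed.

(** For each [b], [slice f b + qm1] dominates [slice f a] and has the near-projection [hs b + qm1],
    so [near_opt_min] applies; every minimum costs one more [delta]. *)
Lemma near_opt_bigmin f a delta (hs : 'I_n -> cpoint n d -> R) (q : seq 'I_n) :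
  (forall b x, slice f a x <= slice f b x + qm1 l u r a b) ->
  (forall b, near_opt (slice f b) (hs b) delta) ->
  near_opt (slice f a)
    (fun x => \big[Num.min/hs a x]_(b <- q) (hs b x + qm1 l u r a b))
    (delta *+ (size q).+1).
Proof.
move=> fr hopt; elim: q => [|b q IH].
  rewrite mulr1n (_ : (fun x => _) = hs a) //.
  by apply: funext => x; rewrite big_nil.
rewrite (_ : (fun x => _) = fun x => Num.min (hs b x + qm1 l u r a b)
    (\big[Num.min/hs a x]_(b <- q) (hs b x + qm1 l u r a b))); last first.
  by apply: funext => x; rewrite big_cons.
rewrite /= mulrS; apply: (near_opt_min _ IH); first exact: fr b.
exact: near_opt_addc.
Qed.

(** The slices are projected one by one, and a lower envelope makes the projections compatible along
    [r]. It is still near-optimal on each slice, where the slice of [k] competes; then slices are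
    averaged. *)
Lemma lip_add_dim f k delta : lip (qm l u) (agree_off [:: r]) f -> lips k ->
  0 < delta ->
  exists2 g, lip (qm l u) (agree_off (r :: s)) g & L1 D f g <= L1 D f k + delta.
Proof.
move=> flip klip d0.
(* The envelope starts from [hs a] and takes [n] minima, hence [n.+1] losses. *)
have d1 : 0 < delta / n.+1%:R by rewrite divr_gt0.
have /choice[hs hsP] : forall b, exists h, near_opt (slice f b) h (delta / n.+1%:R).
  by move=> b; exact: near_opt_exists.
pose g x := \big[Num.min/hs (x r) x]_b (hs b x + qm1 l u r (x r) b).
have g_le x b : g x <= hs b x + qm1 l u r (x r) b by exact: bigmin_le.
have g_eq x : exists b, g x = hs b x + qm1 l u r (x r) b.
  rewrite /g; apply: (big_ind (fun v => exists b, v = hs b x + qm1 l u r (x r) b)).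
  - by exists (x r); rewrite qm1_refl addr0.
  - by move=> v w [b ->] [c ->]; case: leP => _; [exists b|exists c].
  - by move=> b _; exists b.
exists g.
  (* Move first along [r], where only [qm1] changes, then along [s], where [hs b] is Lipschitz. *)
  move=> x y xy; have [b ->] := g_eq y; apply: le_trans (g_le x b) _.
  have [hlip hflat] := (hsP b).1.
  have /hlip : agree_off s (upd x r (y r)) y.
    apply/agree_offP => i is_; rewrite ffunE; case: eqP => [->//|/eqP ir].
    by move/agree_offP: xy; apply; rewrite inE negb_or ir.
  rewrite hflat (qm_upd l u x y r).
  by have := qm1_tri l u r (x r) (y r) b; lra.
have fr a b x : slice f a x <= slice f b x + qm1 l u r a b.
  rewrite -(qm_line l u x r); apply: flip; apply/agree_offP => i.
  by rewrite inE => ir; rewrite !upd_other.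
have L1_slices g' : L1 D f g' = \sum_a p r a * L1 D (slice f a) (slice g' a).
  exact: prodD_resample.
rewrite !L1_slices -[delta in X in _ <= X]mul1r -(p_marg.2 r) mulr_suml -big_split /=.
apply: ler_sum => a _; rewrite -mulrDr; apply: ler_wpM2l; first exact: p_marg.1.
have [_ /(_ _ (flat_slice a klip))] :=
  near_opt_bigmin (index_enum 'I_n) (fr a) hsP.
rewrite -[size _]/(size (Finite.enum 'I_n)) -enumT size_enum_ord -mulr_natr divfK ?pnatr_eq0 //.
congr (_ <= _); apply: eq_bigr => x _; congr (_ * `|_ - _|).
rewrite /slice /g upd_same.
have E b : hs b (upd x r a) = hs b x by exact: (hsP b).1.2.
by rewrite E; apply: eq_bigr => b _; rewrite E.
Qed.

End AddDimension.

(** * Induction on the directions *)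

Section DimensionReduction.
Variables l u : 'I_d -> nat -> R.
Variable p : 'I_d -> 'I_n -> R.
Hypothesis p_marg : is_marginals p.
Let D := prodD p.
Let W s eta f := bracket_width (qm l u) D (agree_off s) eta f.
Implicit Types f : cpoint n d -> R.

Lemma width_add_dim r s f : r \notin s ->
  lip (qm l u) (agree_off [:: r]) f -> W (r :: s) 0 f <= W s 0 f.
Proof.
move=> rs flip; apply/ler_addgt0Pr => delta d0.
have d2 : 0 < delta / 2 by lra.
have D0 := prodD_ge0 p_marg.
have [p1 [q1 [b wle]]] := bracket_width_approx D0 (potential_lip l u)
  (agree_off s) f (lexx 0) d2.
have [k klip kle] := lip_of_bracket (qm_refl l u) (qm_tri l u) D0
  (agree_off_equiv s) b.
have [g glip gle] := lip_add_dim p_marg rs flip klip d2.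
have := bracket_width_le D0 (bracket_of_lip f glip).
by rewrite width_minmax -/D -/(W _ _ _) in gle * ; rewrite -/(W _ _ _) in wle; lra.
Qed.

Lemma gain_le (bad : 'I_d -> pred (cpoint n d)) f eta s : 0 <= eta -> uniq s ->
  (forall r x y, ~~ bad r x -> ~~ bad r y -> agree_off [:: r] x y ->
     f x <= f y + qm l u x y) ->
  W s 0 f - W s eta f <= 4 * eta * \sum_(r <- s) mass D (bad r).
Proof.
move=> eta0 us badP; have D0 := prodD_ge0 p_marg.
elim: s us => [_|r s IH /= /andP[rs us]].
  rewrite big_nil mulr0 subr_le0.
  apply: (@le_trans _ _ 0); last exact: (bracket_width_ge0 D0 (potential_lip l u)).
  have w0 : width D f f = 0 by rewrite /width big1 // => x _; rewrite subrr mulr0.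
  rewrite -[X in _ <= X]w0; apply: bracket_width_le => //; split=> [x|x y /agree_offP xy]; first by rewrite lexx.
  by have -> : x = y; [apply/ffunP => i; exact: xy|rewrite qm_refl !addr0].
rewrite big_cons mulrDr; have {IH} IH := IH us.
(* [f'] repairs [f] along [r], changing it only on [bad r]. *)
have [f' [flip fE]] := lip_extension (qm_refl l u) (qm_tri l u)
  (G := fun x => ~~ bad r x) (agree_off_equiv [:: r])
  (fun x y _ => potential_lip l u x y) (badP r).
have le1 := width_add_dim rs flip.
have le2 := bracket_width_mono D0 (potential_lip l u) f' eta0
  (@agree_off_cons r s).
(* Replacing [f] by [f'] for [r :: s], and [f'] by [f] for [s], costs 2 * eta times the mass each
   time, hence the factor 4. *)
have le3 := bracket_width_exchange D0 (potential_lip l u) (agree_off (r :: s)) f' f eta0.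
have le4 := bracket_width_exchange D0 (potential_lip l u) (agree_off s) f f' eta0.
have sub g : (forall x, ~~ bad r x -> ~~ g x) -> mass D g <= mass D (bad r).
  move=> gb; rewrite /mass big_mkcond [X in _ <= X]big_mkcond; apply: ler_sum => x _.
  case: ifP => [gx|_]; case: ifP => bx; rewrite ?lexx ?D0 //.
  by move/negbT/gb: bx; rewrite gx.
have le5 : mass D (fun x => f x != f' x) <= mass D (bad r).
  by apply: sub => x /fE ->; rewrite eqxx.
have le6 : mass D (fun x => f' x != f x) <= mass D (bad r).
  by apply: sub => x /fE ->; rewrite eqxx.
have := ler_wpM2l eta0 le5; have := ler_wpM2l eta0 le6.
rewrite /W -/D in le1 le2 le3 le4 IH *; lra.
Qed.

(** The gain over all directions is bounded below with factor [eta / 2] and above with factor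
    [4 * eta]; the quotient is 8. *)
Lemma dimension_reduction (bad : 'I_d -> pred (cpoint n d)) f :
  (forall r x y, ~~ bad r x -> ~~ bad r y -> agree_off [:: r] x y ->
     f x <= f y + qm l u x y) ->
  forall delta, 0 < delta ->
  exists2 g, lip (qm l u) (fun _ _ => true) g &
    mass D (fun x => f x != g x) <= 8 * \sum_r mass D (bad r) + delta.
Proof.
move=> badP delta d0; have D0 := prodD_ge0 p_marg.
have [eta eta0 etaP] := lip_dist_le_gain (qm_refl l u) (qm_tri l u) D0
  (potential_lip l u) f.
have [|g glip gle] := etaP (eta / 2 * delta); first by rewrite mulr_gt0 ?divr_gt0.
exists g => //.
have := gain_le (ltW eta0) (enum_uniq 'I_d) badP.
have -> : \sum_(r <- enum 'I_d) mass D (bad r) = \sum_r mass D (bad r).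
  by rewrite big_enum; apply: eq_bigl.
rewrite /W.
have -> : agree_off (enum 'I_d) = fun _ _ => true.
  by apply: funext => x; apply: funext => y; apply/agree_offP => i; rewrite mem_enum.
move=> le1; have e2 : 0 < eta / 2 by lra.
rewrite -(ler_pM2l e2); apply: le_trans gle _; rewrite mulrDr lerD2r.
apply: le_trans le1 _; rewrite le_eqVlt; apply/orP; left; apply/eqP; by field.
Qed.

End DimensionReduction.
End Grid.

(** * The property as a Lipschitz condition for [qm] *)

Section Property.
Variables (R : realType) (n d : nat) (l u : 'I_d -> nat -> R).
Hypothesis lu : bounding_family n l u.
Implicit Types (x y : cpoint n d) (r : 'I_d) (a b : 'I_n) (f : cpoint n d -> R).

Lemma shift_upd x r : ((x r).+1 < n)%N -> shift x r = upd x r (insubd (x r) (x r).+1).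
Proof. by []. Qed.

Lemma psum_gap r (i j : nat) : (i <= j)%N -> (j < n)%N ->
  psum (l r) j - psum (l r) i <= psum (u r) j - psum (u r) i.
Proof.
move=> ij; rewrite -(subnKC ij); elim: (j - i)%N => [|k IH] kn.
  by rewrite addn0 !subrr.
rewrite addnS /psum !big_ord_recr /= -!/(psum _ _).
have := IH ltac:(lia); have := @lu r (i + k)%N ltac:(lia); lra.
Qed.

Lemma qm1_ge r (i j : nat) : (j <= i)%N -> (i < n)%N ->
  qm1 l u r i j = psum (u r) i - psum (u r) j.
Proof. by move=> ji ni; apply: max_l; exact: psum_gap. Qed.

Lemma qm1_le r (i j : nat) : (i <= j)%N -> (j < n)%N ->
  qm1 l u r i j = psum (l r) i - psum (l r) j.
Proof. by move=> ij nj; apply: max_r; have := psum_gap r ij nj; lra. Qed.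

(** Additivity makes a comparison through an intermediate point lossless. *)
Lemma qm1_between r (i j k : nat) : (i <= j <= k)%N -> (k < n)%N ->
  qm1 l u r i k = qm1 l u r i j + qm1 l u r j k /\
  qm1 l u r k i = qm1 l u r k j + qm1 l u r j i.
Proof.
move=> /andP[ij jk] kn; split.
  by rewrite !qm1_le ?(leq_trans ij) ?(leq_ltn_trans jk) //; ring.
by rewrite !qm1_ge ?(leq_trans ij) ?(leq_ltn_trans jk) //; ring.
Qed.

(** Between neighbours [qm] is the upper bound one way and minus the lower bound the other way. *)
Lemma inP_of_lip f : lip (qm l u) (fun _ _ => true) f -> inP l u f.
Proof.
move=> flip r x xr; rewrite shift_upd //.
set a : 'I_n := insubd _ _; have av : a = (x r).+1 :> nat.
  by rewrite /a val_insubd xr.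
have := flip (upd x r a) (upd x r (x r)) isT.
have := flip (upd x r (x r)) (upd x r a) isT.
rewrite !qm_line upd_id qm1_le ?qm1_ge ?av // /psum !big_ord_recr /=; lra.
Qed.

Lemma inP_potential : inP l u (@potential R n d u).
Proof. by apply: inP_of_lip => x y _; exact: potential_lip. Qed.

Lemma inP_line_diff f x r (k : nat) a b : inP l u f -> (a + k = b)%N ->
  psum (l r) b - psum (l r) a <= f (upd x r b) - f (upd x r a)
  <= psum (u r) b - psum (u r) a.
Proof.
move=> fP; elim: k b => [|k IH] b ab.
  have -> : b = a by apply: val_inj; rewrite /= -ab addn0.
  by rewrite !subrr lexx.
have cn : (a + k < n)%N by have := ltn_ord b; lia.
have := IH (Ordinal cn) erefl.
have := fP r (upd x r (Ordinal cn)); rewrite upd_same /=.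
have -> : (a + k).+1 = b by lia.
move=> /(_ (ltn_ord b)).
have -> : shift (upd x r (Ordinal cn)) r = upd x r b.
  rewrite shift_upd upd_same /=; last by rewrite -addnS ab.
  rewrite upd_upd; congr upd; apply: val_inj; rewrite val_insubd /=.
  by rewrite -addnS ab ltn_ord.
have -> : psum (u r) b = psum (u r) (a + k) + u r (a + k)%N.
  by rewrite -ab addnS /psum big_ord_recr.
have -> : psum (l r) b = psum (l r) (a + k) + l r (a + k)%N.
  by rewrite -ab addnS /psum big_ord_recr.
lra.
Qed.

Lemma inP_line f x r a b : inP l u f ->
  f (upd x r a) <= f (upd x r b) + qm1 l u r a b.
Proof.
move=> fP; have [ab|ba] := leqP a b.
  rewrite qm1_le //.
  by have := @inP_line_diff f x r (b - a)%N a b fP (subnKC ab); lra.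
rewrite qm1_ge //; last exact: ltnW.
by have := @inP_line_diff f x r (a - b)%N b a fP (subnKC (ltnW ba)); lra.
Qed.

Lemma distD_le (D : cpoint n d -> R) f g : (forall x, 0 <= D x) -> inP l u g ->
  distD D l u f <= mass D (fun x => f x != g x).
Proof.
move=> D0 gP; apply: ge_inf; last by exists g.
by exists 0 => _ [h [_ ->]]; apply: sumr_ge0.
Qed.

Lemma distD_le1 (p : 'I_d -> 'I_n -> R) f : is_marginals p ->
  distD (prodD p) l u f <= 1.
Proof.
move=> p_marg; apply: le_trans (distD_le _ (prodD_ge0 p_marg) inP_potential) _.
rewrite -(prodD_sum1 p_marg) /mass big_mkcond; apply: ler_sum => x _.
by case: ifP => // _; exact: prodD_ge0.
Qed.

Lemma distD_inP (p : 'I_d -> 'I_n -> R) f : is_marginals p -> inP l u f ->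
  distD (prodD p) l u f <= 0.
Proof.
move=> p_marg fP; apply: le_trans (distD_le _ (prodD_ge0 p_marg) fP) _.
by rewrite /mass big_pred0 // => x; rewrite eqxx.
Qed.

End Property.

(** * Dyadic separation and numerical estimates *)

(* The root of the dyadic block of length 2^(t+1) containing i: two numbers whose
   highest distinct bit is t are separated by their common root at level t. *)
Definition dyadic_root (i t : nat) := (i %/ 2 ^ t.+1 * 2 ^ t.+1 + 2 ^ t)%N.

Lemma dyadic_root_between L i j : (i < j)%N -> (j < 2 ^ L)%N ->
  exists2 t, (t < L)%N &
    dyadic_root i t = dyadic_root j t /\ (i <= dyadic_root i t <= j)%N.
Proof.
move=> ij jL; pose P t := (i %/ 2 ^ t == j %/ 2 ^ t)%N.
have PL : P L by rewrite /P !divn_small // (ltn_trans ij).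
(* The least level at which [i] and [j] share a block is not 0, where blocks are single points. *)
case: (ex_minnP (ex_intro _ L PL)) => -[|t] Pt tmin.
  by move: Pt; rewrite /P expn0 !divn1 (ltn_eqF ij).
exists t; first exact: tmin.
move/eqP: Pt => Pt; split; first by rewrite /dyadic_root Pt.
have neq : (i %/ 2 ^ t != j %/ 2 ^ t)%N by apply/negP => /tmin; rewrite ltnn.
have le : (i %/ 2 ^ t <= j %/ 2 ^ t)%N by rewrite leq_div2r // ltnW.
have Pt2 : ((i %/ 2 ^ t) %/ 2 = (j %/ 2 ^ t) %/ 2)%N.
  by rewrite -!divnMA -expnSr.
(* One level below, [i] and [j] lie in the left and right halves, and the root is the first point of
   the right half. *)
have rootE : dyadic_root i t = (j %/ 2 ^ t * 2 ^ t)%N.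
  have -> : (j %/ 2 ^ t = (i %/ 2 ^ t %/ 2 * 2).+1)%N by move: le neq Pt2; lia.
  by rewrite /dyadic_root expnSr divnMA mulSn addnC -mulnA [(2 * _)%N]mulnC.
rewrite rootE leq_divM andbT.
have : (i < (i %/ 2 ^ t).+1 * 2 ^ t)%N by rewrite ltn_ceil // expn_gt0.
move=> /ltnW /leq_trans; apply; rewrite leq_mul2r; apply/orP; right.
by rewrite ltn_neqAle neq.
Qed.

Lemma sum_tuple_prod (R : comPzRingType) (T : finType) k (F : 'I_k -> T -> R) :
  \sum_(s : k.-tuple T) \prod_i F i (tnth s i) = \prod_i \sum_x F i x.
Proof.
rewrite bigA_distr_bigA (reindex (@tuple_of_finfun T k)) /=; last first.
  exact: onW_bij (Bijective (@tuple_of_finfunK T k) (@finfun_of_tupleK T k)).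
apply: eq_bigr => f _; apply: eq_bigr => i _; congr F.
by rewrite -{2}(tuple_of_finfunK f) ffunE.
Qed.

Lemma natr_forall (R : comPzRingType) k (P : pred 'I_k) :
  ([forall i, P i])%:R = \prod_i (P i)%:R :> R.
Proof.
case: (boolP [forall i, P i]) => [/forallP h|/forallPn[i /negbTE Pi]].
  by rewrite big1 // => i _; rewrite h.
by rewrite (bigD1 i) //= Pi mul0r.
Qed.

(** By Bernoulli (1 + x)^k is above 3, and its product with (1 - x)^k is at most 1. *)
Lemma pow_lt_third (R : realType) (x : R) k : 0 <= x <= 1 -> 2 < x * k%:R ->
  (1 - x) ^+ k < 1 / 3.
Proof.
move=> /andP[x0 x1] xk.
have bern : 1 + x * k%:R <= (1 + x) ^+ k.
  elim: k {xk} => [|k IH]; first by rewrite mulr0 addr0 expr0.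
  rewrite exprS -natr1; apply: le_trans (ler_wpM2l _ IH); last by lra.
  by have : 0 <= x * x * k%:R; [rewrite !mulr_ge0|lra].
have : (1 - x) ^+ k * (1 + x) ^+ k <= 1.
  rewrite -exprMn; apply: exprn_ile1; first by rewrite mulr_ge0 //; lra.
  by have : 0 <= x * x; [rewrite mulr_ge0|lra].
have y0 : 0 <= (1 - x) ^+ k by rewrite exprn_ge0 //; lra.
have := ler_wpM2l y0 bern.
move: y0; set y := (1 - x) ^+ k; set c := x * _ in xk *; nra.
Qed.

Lemma up_log_le_log2 (R : realType) n : (1 < n)%N ->
  1 <= log2 n%:R :> R /\ (up_log 2 n)%:R <= 1 + log2 n%:R :> R.
Proof.
move=> n1; have ln2 : 0 < ln (2 : R) by rewrite ln_gt0 // ltr1n.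
have n0 : 0 < n%:R :> R by rewrite ltr0n ltnW.
rewrite /log2; split.
  by rewrite ler_pdivlMr // mul1r ler_ln ?posrE // ler_nat.
have /andP[lt _] := up_log_bounds (ltnSn 1) n1.
rewrite -lerBlDl ler_pdivlMr //.
case: (up_log 2 n) lt => [|L] /= lt.
  have : 0 <= ln (n%:R : R) by rewrite ln_ge0 // ler1n ltnW.
  by rewrite sub0r; lra.
rewrite -natr1 addrK mulr_natl -lnXn // ler_ln ?posrE ?exprn_gt0 //.
by rewrite -natrX ler_nat ltnW.
Qed.

(** * The tester and its analysis *)

Section Tester.
Variables (R : realType) (n d : nat) (l u : 'I_d -> nat -> R).
Hypothesis lu : bounding_family n l u.
Implicit Types (x y : cpoint n d) (r : 'I_d) (i j : 'I_n) (f : cpoint n d -> R).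

(** A root outside the grid is replaced by [i], where the test compares a value with itself and
    passes. *)
Definition probe i (t : nat) : 'I_n := insubd i (dyadic_root i t).

Definition consistent r i (v : R) j (w : R) : bool :=
  (v <= w + qm1 l u r i j) && (w <= v + qm1 l u r j i).

Definition bad f r x : bool :=
  ~~ [forall t : 'I_(up_log 2 n),
    consistent r (x r) (f x) (probe (x r) t) (f (upd x r (probe (x r) t)))].

Lemma inP_not_bad f r x : inP l u f -> ~~ bad f r x.
Proof.
move=> fP; rewrite negbK; apply/forallP => t.
have := inP_line lu x r (x r) (probe (x r) t) fP.
have := inP_line lu x r (probe (x r) t) (x r) fP.
by rewrite upd_id /consistent => -> ->.
Qed.

Lemma probe_between i j : (i < j)%N -> exists t : 'I_(up_log 2 n),
  probe i t = probe j t /\ (i <= probe i t <= j)%N.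
Proof.
move=> ij.
have jL : (j < 2 ^ up_log 2 n)%N by apply: leq_trans (up_logP _ _).
have [t tL [E /andP[le1 le2]]] := dyadic_root_between ij jL.
exists (Ordinal tL) => /=; have lt := leq_ltn_trans le2 (ltn_ord j).
have v (k : 'I_n) : (dyadic_root k t < n)%N -> probe k t = dyadic_root k t :> nat.
  by move=> h; rewrite /probe val_insubd h.
split; first by apply: val_inj; rewrite /= !v -?E.
by rewrite v // le1.
Qed.

(** Both points passed the test against a common probe between them, and the two inequalities add up
    by [qm1_between]. So [bad f r] covers all violations along [r]. *)
Lemma not_bad_line f r x y : ~~ bad f r x -> ~~ bad f r y ->
  agree_off [:: r] x y -> f x <= f y + qm l u x y.
Proof.
rewrite !negbK => /forallP gx /forallP gy /agree_off_line yE.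
have via (t : 'I_(up_log 2 n)) : probe (x r) t = probe (y r) t ->
    qm1 l u r (x r) (y r)
    = qm1 l u r (x r) (probe (x r) t) + qm1 l u r (probe (x r) t) (y r) ->
    f x <= f y + qm l u x y.
  move=> E q; have /andP[h1 _] := gx t; have /andP[_ h2] := gy t.
  have -> : qm l u x y = qm1 l u r (x r) (y r).
    by rewrite -(qm_line l u x) upd_id -yE.
  move: h2; rewrite -E; have -> : upd y r (probe (x r) t) = upd x r (probe (x r) t).
    by rewrite yE upd_upd.
  by move: h1; rewrite q; lra.
have [ij|ji|ij] := ltngtP (x r) (y r).
- have [t [E le]] := probe_between ij.
  by apply: (via t E); have [q _] := qm1_between lu r le (ltn_ord _).
- have [t [E le]] := probe_between ji.
  by apply: (via t); rewrite -E //; have [_ q] := qm1_between lu r le (ltn_ord _).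
- have -> : x = y by rewrite yE -(val_inj ij) upd_id.
  by rewrite qm_refl addr0.
Qed.

Section Rounds.
Variable k : nat.
Local Notation L := (up_log 2 n).

Definition probes (w : {ffun 'I_k -> 'I_d}) (s : k.-tuple (cpoint n d)) :
    #|{: 'I_k * 'I_L}|.-tuple (cpoint n d) :=
  [tuple (let: (i, t) := enum_val z in
          upd (tnth s i) (w i) (probe (tnth s i (w i)) t))
   | z < #|{: 'I_k * 'I_L}|].

Definition line_tester : tester R n d :=
  @Tester R n d {ffun 'I_k -> 'I_d} (fun=> \prod_(i < k) d%:R^-1) k
    #|{: 'I_k * 'I_L}| probes
    (fun w s v q => [forall i : 'I_k, [forall t : 'I_L,
       consistent (w i) (tnth s i (w i)) (tnth v i)
         (probe (tnth s i (w i)) t) (tnth q (enum_rank (i, t)))]]).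

Lemma line_tester_complexity : query_complexity line_tester = (k * L.+1)%N.
Proof. by rewrite /query_complexity /= card_prod !card_ord mulnS. Qed.

Lemma line_tester_decide f w s :
  decide (t := line_tester) w s (map_tuple f s) (map_tuple f (queries (t := line_tester) w s))
  = [forall i, ~~ bad f (w i) (tnth s i)].
Proof.
apply: eq_forallb => i; rewrite negbK; apply: eq_forallb => t.
by rewrite !tnth_map tnth_ord_tuple enum_rankK.
Qed.

(** Samples and directions are independent over the rounds, so both sums factor. *)
Lemma line_tester_acc_prob f (p : 'I_d -> 'I_n -> R) : is_marginals p ->
  acc_prob line_tester (prodD p) f
  = (\sum_r d%:R^-1 * (1 - mass (prodD p) (bad f r))) ^+ k.
Proof.
move=> p_marg; rewrite /acc_prob.
transitivity (\sum_(w : {ffun 'I_k -> 'I_d})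
    \prod_i (d%:R^-1 * (1 - mass (prodD p) (bad f (w i))))).
  apply: eq_bigr => w _; rewrite big_split /=; congr (_ * _).
  transitivity (\sum_(s : k.-tuple (cpoint n d))
      \prod_i (prodD p (tnth s i) * (~~ bad f (w i) (tnth s i))%:R)).
    apply: eq_bigr => s _; rewrite big_split /=; congr (_ * _).
    by rewrite -(natr_forall _ (fun i : 'I_k => ~~ bad f (w i) (tnth s i))) -line_tester_decide.
  rewrite (sum_tuple_prod (fun (i : 'I_k) x => prodD p x * (~~ bad f (w i) x)%:R)).
  apply: eq_bigr => i _; rewrite -[X in _ = X - _](prodD_sum1 p_marg) /mass [X in _ - X]big_mkcond.
  rewrite -sumrB; apply: eq_bigr => x _.
  by case: bad; rewrite ?mulr0 ?subrr ?mulr1 ?subr0.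
rewrite -(bigA_distr_bigA (fun (i : 'I_k) r =>
  d%:R^-1 * (1 - mass (prodD p) (bad f r)))).
by rewrite prodr_const card_ord.
Qed.

End Rounds.

Lemma distD_le_bad f (p : 'I_d -> 'I_n -> R) : is_marginals p ->
  distD (prodD p) l u f <= 8 * \sum_r mass (prodD p) (bad f r).
Proof.
move=> p_marg; apply/ler_addgt0Pr => delta d0.
have [g glip] := dimension_reduction p_marg (@not_bad_line f) d0.
by apply: le_trans; apply: distD_le (prodD_ge0 p_marg) (inP_of_lip lu glip).
Qed.

Lemma mass_prodD_le1 (p : 'I_d -> 'I_n -> R) E : is_marginals p ->
  mass (prodD p) E <= 1.
Proof.
move=> p_marg; rewrite -(prodD_sum1 p_marg) /mass big_mkcond.
by apply: ler_sum => x _; case: ifP => // _; exact: prodD_ge0.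
Qed.

Lemma line_tester_correct (eps : R) k : (0 < d)%N -> 0 < eps ->
  24 * d%:R / eps < k%:R ->
  valid_randomness (line_tester k) /\
  forall p : 'I_d -> 'I_n -> R, is_marginals p -> forall f,
    (inP l u f -> acc_prob (line_tester k) (prodD p) f = 1) /\
    (distD (prodD p) l u f > eps -> acc_prob (line_tester k) (prodD p) f < 1 / 3).
Proof.
move=> d0 eps0 hk.
have dR : 0 < d%:R :> R by rewrite ltr0n.
have sumd : \sum_(r < d) d%:R^-1 = 1 :> R.
  by rewrite sumr_const card_ord -[_ *+ d]mulr_natr mulVf // gt_eqF.
split.
  split=> [w|]; first by apply: prodr_ge0 => i _; rewrite invr_ge0 ltW.
  rewrite -(bigA_distr_bigA (fun (i : 'I_k) (r : 'I_d) => d%:R^-1)).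
  by rewrite big1.
move=> p p_marg f; split=> [fP|far].
  rewrite line_tester_acc_prob //.
  rewrite (eq_bigr (fun=> d%:R^-1)) ?sumd ?expr1n // => r _.
  rewrite /mass big_pred0 ?subr0 ?mulr1 // => x.
  exact/negbTE/inP_not_bad.
rewrite line_tester_acc_prob //.
set S := \sum_r mass (prodD p) (bad f r).
have -> : \sum_r d%:R^-1 * (1 - mass (prodD p) (bad f r)) = 1 - S / d%:R.
  rewrite -mulr_sumr sumrB sumr_const card_ord mulrBr mulVf ?gt_eqF //.
  by rewrite [X in _ - X]mulrC.
have S0 : 0 <= S by apply: sumr_ge0 => r _; apply: mass_ge0; exact: prodD_ge0.
have Sd : S <= d%:R.
  rewrite -[d%:R]mulr1 mulr_natl -[in X in _ <= X](card_ord d) -sumr_const.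
  by apply: ler_sum => r _; exact: mass_prodD_le1.
have Seps : eps < 8 * S by apply: lt_le_trans far _; exact: distD_le_bad.
apply: pow_lt_third.
  by rewrite ler_pdivrMr // mul1r Sd andbT divr_ge0 // ltW.
(* A round rejects with probability S / d > eps / (8 d), and k > 24 d / eps gives k S / d > 3. *)
rewrite mulrAC ltr_pdivlMr //.
move: hk; rewrite ltr_pdivrMr // => hk.
have k0 : 0 < k%:R :> R.
  by rewrite -(pmulr_lgt0 _ eps0); apply: le_lt_trans hk; rewrite mulr_ge0 // ltW.
have : eps * k%:R < 8 * S * k%:R by rewrite ltr_pM2r.
by lra.
Qed.

End Tester.

(** * The trivial tester and the theorem *)

Definition accept_all (R : realType) n d : tester R n d :=
  @Tester R n d unit (fun=> 1) 0 0 (fun _ _ => [tuple]) (fun _ _ _ _ => true).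

Lemma accept_all_acc_prob (R : realType) n d (D f : cpoint n d -> R) :
  acc_prob (accept_all R n d) D f = 1.
Proof.
transitivity (\sum_(w : unit) (1 : R)); last by rewrite sumr_const card_unit.
apply: eq_bigr => w _; rewrite mul1r.
under eq_bigr => s _ do rewrite big_ord0 mulr1.
by rewrite sumr_const card_tuple expn0.
Qed.

Lemma accept_all_valid (R : realType) n d : valid_randomness (accept_all R n d).
Proof. by split=> [w|]; rewrite /= ?ler01 // sumr_const card_unit. Qed.

Theorem theorem1p7 (R : realType) (n d : nat) (l u : 'I_d -> nat -> R)
  (eps : R) :
  bounding_family n l u -> 0 < eps ->
  exists T : tester R n d,
    valid_randomness T /\
    (query_complexity T)%:R <= 100 / eps * d%:R * log2 n%:R /\
    forall p : 'I_d -> 'I_n -> R, is_marginals p ->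
    forall f : cpoint n d -> R,
      (inP l u f -> acc_prob T (prodD p) f = 1) /\
      (distD (prodD p) l u f > eps -> acc_prob T (prodD p) f < 1 / 3).
Proof.
move=> lu eps0.
(* If nothing is ever far, no query is made. Otherwise d > 0, n > 1 and eps < 1, which leaves room
   for rounding in the query bound. *)
have [dist_le|] := pselect (forall p : 'I_d -> 'I_n -> R, is_marginals p ->
    forall f, distD (prodD p) l u f <= eps).
  exists (accept_all R n d); split; first exact: accept_all_valid.
  split.
    have log0 : 0 <= log2 n%:R :> R.
      rewrite /log2; case: (n) => [|k]; first by rewrite ln0 ?mul0r.
      by rewrite divr_ge0 ?ln_ge0 ?ler1n.
    by apply: mulr_ge0 => //; apply: mulr_ge0 => //; rewrite divr_ge0 // ltW.
  move=> p p_marg f; rewrite accept_all_acc_prob; split=> //.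
  by rewrite ltNge dist_le.
move=> far.
have vacuous (h : (d == 0%N) || (n <= 1)%N) : forall f : cpoint n d -> R, inP l u f.
  by move=> f r x xr; have := ltn_ord r; move: h xr; lia.
have nontriv : ~~ ((d == 0%N) || (n <= 1)%N).
  apply/negP => /vacuous P; apply: far => p p_marg f.
  exact: le_trans (distD_inP p_marg (P f)) (ltW eps0).
have eps1 : eps < 1.
  rewrite ltNge; apply/negP => e1; apply: far => p p_marg f.
  exact: le_trans (distD_le1 lu f p_marg) e1.
move: nontriv; rewrite negb_or -lt0n -ltnNge => /andP[d0 n1].
pose K : R := 24 * d%:R / eps.
have K0 : 0 <= K by rewrite divr_ge0 ?mulr_ge0 // ltW.
have [valid correct] := line_tester_correct lu d0 eps0 (truncnS_gt K).
exists (line_tester n l u (Num.trunc K).+1); split => //; split => //.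
rewrite line_tester_complexity natrM -natr1.
have tK : (Num.trunc K)%:R <= K by rewrite truncn_le.
have [lg1 lgL] := up_log_le_log2 R n1.
have dR : 1 <= d%:R :> R by rewrite ler1n.
have de : 1 <= d%:R / eps by rewrite ler_pdivlMr // mul1r; lra.
(* There are at most 24 d / eps + 1 <= 25 d / eps rounds, each with at most 2 + log n <= 4 log n
   queries. *)
apply: (@le_trans _ _ ((25 * (d%:R / eps)) * (4 * log2 n%:R))); last first.
  rewrite le_eqVlt; apply/orP; left; apply/eqP; field; exact: lt0r_neq0.
apply: ler_pM => //; first by rewrite addr_ge0.
  by rewrite /K -mulrA in tK *; lra.
by rewrite -natr1; lra.
Qed.
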